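(* Let $k$ be a field. Then $\mathtt{Stateful}_k$ is a PROP. Here $\mathtt{Stateful}_k$ has the same objects as $\mathtt{FinVect}_{k(s)}$; its morphisms are the morphisms of $\Box(\mathtt{FinVect}_{k(s)})$ of the form $(D,C,(sI-A)^{-1},B)$ for some linear maps $A,B,C,D$ in $\mathtt{FinVect}_k$ (regarded over $k(s)$); and its composition, identities, monoidal product and symmetry are those of $\Box(\mathtt{FinVect}_{k(s)})$.
   Context: A PROP is a strict symmetric monoidal category whose objects are the natural numbers, with monoidal product of objects given by addition. For a field $K$, $\mathtt{FinVect}_K$ is the PROP whose objects are the vector spaces $K^n$ (identified with $n\in\mathbb N$), with linear maps as morphisms and direct sum as tensor product. $k(s)$ is the field of rational functions in one variable $s$ over $k$. $\Box(\mathtt{FinVect}_K)$ has the same objects as $\mathtt{FinVect}_K$. A morphism $V_1\to V_2$ is an equivalence class of quadruples $(d,c,a,b)$ of linear maps in $\mathtt{FinVect}_K$, with $d\colon V_1\to V_2$, $b\colon V_1\to S$, $a\colon S\to T$, $c\colon T\to V_2$ for some objects $S,T$. Two quadruples $(d,c,a,b)$ (with spaces $S,T$) and $(d,c',a',b')$ (with spaces $S',T'$) are equivalent if there are isomorphisms $\alpha\colon S\to S'$ and $\omega\colon T\to T'$ with $\alpha b=b'$, $\omega a=a'\alpha$, $c=c'\omega$. Composition is $$(d',c',a',b')\circ(d,c,a,b)=\Big(d'd,\ [\,d'c\ \ c'\,],\ \begin{bmatrix} a & 0 \\ {a'b'ca} & a' \end{bmatrix},\ \begin{bmatrix} b \\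 {b'd} \end{bmatrix}\Big),$$ with intermediate spaces $S\oplus S'$ and $T\oplus T'$. The monoidal product is direct sum on objects and entrywise direct sum on morphisms. Identities and symmetries are those of $\mathtt{FinVect}_K$ placed in the first entry, with $S=T=0$. In $(D,C,(sI-A)^{-1},B)\colon k(s)^m\to k(s)^p$ one has $S=T=k(s)^n$ for some $n$, $I$ is the identity of $k(s)^n$, and $A\colon k^n\to k^n$, $B\colon k^m\to k^n$, $C\colon k^n\to k^p$, $D\colon k^m\to k^p$. The matrix $sI-A$ is invertible over $k(s)$. *)

(* Defs.v *)
From HB Require Import structures.
From mathcomp Require Import all_boot all_order all_algebra.
From mathcomp Require Import boolp.

Set Implicit Arguments.
Unset Strict Implicit.
Unset Printing Implicit Defensive.

Import GRing.Theory.
Local Open Scope ring_scope.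
Local Open Scope quotient_scope.

Record PROP_data : Type := PROPData {
  hom : nat -> nat -> Type;
  hid : forall n, hom n n;
  (* [hcomp g f] is g after f *)
  hcomp : forall m n p, hom n p -> hom m n -> hom m p;
  htens : forall m1 n1 m2 n2,
    hom m1 n1 -> hom m2 n2 -> hom (m1 + m2)%N (n1 + n2)%N;
  hsym : forall m n, hom (m + n)%N (n + m)%N }.

(* The objects (m1 + m2) + m3 and m1 + (m2 + m3) are equal but not
   convertible, so the strictness equations between morphisms are stated up to
   transport along equalities of objects. *)
Definition cast_hom (P : PROP_data) m m' n n' (em : m = m') (en : n = n')
    (f : hom P m n) : hom P m' n' :=
  ecast i (hom P m' i) en (ecast i (hom P i n) em f).

Record is_PROP (P : PROP_data) : Prop := IsPROP {
  compA : forall m n p q (h : hom P p q) (g : hom P n p) (f : hom P m n),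
    hcomp h (hcomp g f) = hcomp (hcomp h g) f;
  comp1m : forall m n (f : hom P m n), hcomp (hid P n) f = f;
  compm1 : forall m n (f : hom P m n), hcomp f (hid P m) = f;
  tens1 : forall m n, htens (hid P m) (hid P n) = hid P (m + n)%N;
  tens_comp : forall m1 n1 p1 m2 n2 p2
      (g1 : hom P n1 p1) (f1 : hom P m1 n1)
      (g2 : hom P n2 p2) (f2 : hom P m2 n2),
    htens (hcomp g1 f1) (hcomp g2 f2) = hcomp (htens g1 g2) (htens f1 f2);
  tensA : forall m1 n1 m2 n2 m3 n3
      (f : hom P m1 n1) (g : hom P m2 n2) (h : hom P m3 n3),
    cast_hom (addnA m1 m2 m3) (addnA n1 n2 n3) (htens f (htens g h))
    = htens (htens f g) h;
  tens0m : forall m n (f : hom P m n),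
    cast_hom (add0n m) (add0n n) (htens (hid P 0%N) f) = f;
  tensm0 : forall m n (f : hom P m n),
    cast_hom (addn0 m) (addn0 n) (htens f (hid P 0%N)) = f;
  sym_nat : forall m1 n1 m2 n2 (f : hom P m1 n1) (g : hom P m2 n2),
    hcomp (hsym P n1 n2) (htens f g) = hcomp (htens g f) (hsym P m1 m2);
  symK : forall m n, hcomp (hsym P n m) (hsym P m n) = hid P (m + n)%N;
  sym_hexagon : forall m n p,
    cast_hom (addnA m n p) (esym (addnA n p m)) (hsym P m (n + p)%N)
    = hcomp (htens (hid P n) (hsym P m p))
            (cast_hom (erefl (m + n + p)%N) (esym (addnA n m p))
                      (htens (hsym P m n) (hid P p)));
  sym_unit : forall m,
    cast_hom (addn0 m) (add0n m) (hsym P m 0%N) = hid P m }.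

Record sub_closed (P : PROP_data) (S : forall m n, hom P m n -> Prop) : Prop :=
  SubClosed {
  sub_idm : forall n, S n n (hid P n);
  sub_comp : forall m n p (g : hom P n p) (f : hom P m n),
    S n p g -> S m n f -> S m p (hcomp g f);
  sub_tens : forall m1 n1 m2 n2 (f : hom P m1 n1) (g : hom P m2 n2),
    S m1 n1 f -> S m2 n2 g -> S (m1 + m2)%N (n1 + n2)%N (htens f g);
  sub_sym : forall m n, S (m + n)%N (n + m)%N (hsym P m n) }.

Definition sub_PROP_data (P : PROP_data) (S : forall m n, hom P m n -> Prop)
    (hS : sub_closed S) : PROP_data :=
  @PROPData (fun m n => {f : hom P m n | S m n f})
    (fun n => exist _ _ (sub_idm hS n))
    (fun m n p g f => exist _ _ (sub_comp hS (svalP g) (svalP f)))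
    (fun m1 n1 m2 n2 f g => exist _ _ (sub_tens hS (svalP f) (svalP g)))
    (fun m n => exist _ _ (sub_sym hS m n)).

(* A linear map K^m -> K^n is its matrix in 'M[K]_(n, m), acting on column
   vectors, so that composition g o f is g *m f. *)

Definition mx_iso (K : fieldType) m n (f : 'M[K]_(n, m)) : Prop :=
  exists2 g : 'M[K]_(m, n), g *m f = 1%:M & f *m g = 1%:M.

Definition dsum_mx (K : fieldType) m1 n1 m2 n2
    (f : 'M[K]_(n1, m1)) (g : 'M[K]_(n2, m2)) : 'M[K]_(n1 + n2, m1 + m2) :=
  block_mx f 0 0 g.

(* (x, y) |-> (y, x) *)
Definition swap_mx (K : fieldType) m n : 'M[K]_(n + m, m + n) :=
  block_mx 0 1%:M 1%:M 0.

Lemma mx_iso1 (K : fieldType) n : mx_iso (1%:M : 'M[K]_n).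
Proof. by exists 1%:M; rewrite mulmx1. Qed.

Lemma mx_isoM (K : fieldType) m n p (g : 'M[K]_(p, n)) (f : 'M[K]_(n, m)) :
  mx_iso g -> mx_iso f -> mx_iso (g *m f).
Proof.
move=> [g' g'g gg'] [f' f'f ff']; exists (f' *m g').
  by rewrite mulmxA -(mulmxA f') g'g mulmx1.
by rewrite mulmxA -(mulmxA g) ff' mulmx1.
Qed.

Lemma dsum_mxM (K : fieldType) m1 n1 p1 m2 n2 p2
    (g1 : 'M[K]_(p1, n1)) (f1 : 'M[K]_(n1, m1))
    (g2 : 'M[K]_(p2, n2)) (f2 : 'M[K]_(n2, m2)) :
  dsum_mx (g1 *m f1) (g2 *m f2) = dsum_mx g1 g2 *m dsum_mx f1 f2.
Proof.
by rewrite /dsum_mx mulmx_block !mulmx0 !mul0mx !addr0 add0r.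
Qed.

Lemma mx_iso_dsum (K : fieldType) m1 n1 m2 n2
    (f : 'M[K]_(n1, m1)) (g : 'M[K]_(n2, m2)) :
  mx_iso f -> mx_iso g -> mx_iso (dsum_mx f g).
Proof.
move=> [f' f'f ff'] [g' g'g gg']; exists (dsum_mx f' g').
  by rewrite -dsum_mxM f'f g'g /dsum_mx -scalar_mx_block.
by rewrite -dsum_mxM ff' gg' /dsum_mx -scalar_mx_block.
Qed.

Record quad (K : fieldType) (m p : nat) : Type := Quad {
  qS : nat; qT : nat;
  qd : 'M[K]_(p, m);
  qc : 'M[K]_(p, qT);
  qa : 'M[K]_(qT, qS);
  qb : 'M[K]_(qS, m) }.
Arguments Quad {K m p qS qT} qd qc qa qb.

(* Only used to derive the choice structure needed to form the quotient. *)
Definition quad_code (K : fieldType) m p (q : quad K m p) :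
    {ST : nat * nat & ('M[K]_(p, m) * 'M[K]_(p, ST.2)
                       * 'M[K]_(ST.2, ST.1) * 'M[K]_(ST.1, m))%type} :=
  existT _ (qS q, qT q) (qd q, qc q, qa q, qb q).

Definition quad_decode (K : fieldType) m p
    (x : {ST : nat * nat & ('M[K]_(p, m) * 'M[K]_(p, ST.2)
                            * 'M[K]_(ST.2, ST.1) * 'M[K]_(ST.1, m))%type}) :
    quad K m p :=
  let: existT _ (d, c, a, b) := x in Quad d c a b.

Lemma quad_codeK (K : fieldType) m p :
  cancel (@quad_code K m p) (@quad_decode K m p).
Proof. by case. Qed.

HB.instance Definition _ (K : fieldType) m p :=
  Choice.copy (quad K m p) (can_type (@quad_codeK K m p)).

Definition quad_equiv_prop (K : fieldType) m p (q q' : quad K m p) : Prop :=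
  qd q = qd q' /\
  exists (alpha : 'M[K]_(qS q', qS q)) (omega : 'M[K]_(qT q', qT q)),
    [/\ mx_iso alpha, mx_iso omega,
        alpha *m qb q = qb q',
        omega *m qa q = qa q' *m alpha
      & qc q = qc q' *m omega].

Lemma quad_equiv_refl (K : fieldType) m p (q : quad K m p) :
  quad_equiv_prop q q.
Proof.
split=> //; exists 1%:M, 1%:M; split; try exact: mx_iso1.
- by rewrite mul1mx.
- by rewrite mul1mx mulmx1.
- by rewrite mulmx1.
Qed.

Lemma quad_equiv_sym (K : fieldType) m p (q q' : quad K m p) :
  quad_equiv_prop q q' -> quad_equiv_prop q' q.
Proof.
case=> ed [al [om [[al' l1 l2] [om' o1 o2] eb ea ec]]].
split=> //; exists al', om'; split.
- by exists al.
- by exists om.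
- by rewrite -eb mulmxA l1 mul1mx.
- rewrite -[LHS]mulmx1 -l2 !mulmxA -(mulmxA om') -ea mulmxA o1.
  by rewrite mul1mx.
- by rewrite ec -mulmxA o2 mulmx1.
Qed.

Lemma quad_equiv_trans (K : fieldType) m p (q q' q'' : quad K m p) :
  quad_equiv_prop q q' -> quad_equiv_prop q' q'' -> quad_equiv_prop q q''.
Proof.
case=> ed [al [om [il io eb ea ec]]] [ed' [al' [om' [il' io' eb' ea' ec']]]].
split; first by rewrite ed.
exists (al' *m al), (om' *m om); split; try exact: mx_isoM.
- by rewrite -mulmxA eb.
- by rewrite -mulmxA ea !mulmxA ea'.
- by rewrite mulmxA -ec'.
Qed.

Definition quad_equiv (K : fieldType) m p : rel (quad K m p) :=
  fun q q' => `[< quad_equiv_prop q q' >].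

Lemma quad_equivP (K : fieldType) m p :
  equiv_class_of (@quad_equiv K m p).
Proof.
split.
- by move=> q; apply/asboolP/quad_equiv_refl.
- by move=> q q'; apply/asboolP/asboolP; apply: quad_equiv_sym.
- move=> q' q q'' /asboolP h /asboolP h'.
  by apply/asboolP; apply: quad_equiv_trans h h'.
Qed.

Canonical quad_equiv_rel (K : fieldType) m p :=
  EquivRelPack (@quad_equivP K m p).

Definition box_hom (K : fieldType) (m p : nat) : Type :=
  {eq_quot (@quad_equiv K m p)}.

Definition box_class (K : fieldType) m p (q : quad K m p) : box_hom K m p :=
  \pi_({eq_quot (@quad_equiv K m p)}) q.

Definition box_repr (K : fieldType) m p (f : box_hom K m p) : quad K m p :=
  repr (f : {eq_quot (@quad_equiv K m p)}).

Lemma box_reprK (K : fieldType) m p (f : box_hom K m p) :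
  box_class (box_repr f) = f.
Proof. exact: reprK. Qed.

Lemma box_classP (K : fieldType) m p (q q' : quad K m p) :
  box_class q = box_class q' <-> quad_equiv_prop q q'.
Proof.
by split=> [/eqmodP/asboolP // | h]; apply/eqmodP/asboolP.
Qed.

Lemma box_repr_class (K : fieldType) m p (q : quad K m p) :
  quad_equiv_prop (box_repr (box_class q)) q.
Proof. by apply/box_classP; rewrite box_reprK. Qed.

(* FinVect sits in the box in the first entry, with S = T = 0. *)
Definition quad_of_mx (K : fieldType) m p (d : 'M[K]_(p, m)) : quad K m p :=
  @Quad K m p 0%N 0%N d 0 0 0.

Definition quad_comp (K : fieldType) m n p
    (q' : quad K n p) (q : quad K m n) : quad K m p :=
  Quad (qd q' *m qd q)
       (row_mx (qd q' *m qc q) (qc q'))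
       (block_mx (qa q) 0 (qa q' *m qb q' *m qc q *m qa q) (qa q'))
       (col_mx (qb q) (qb q' *m qd q)).

Definition quad_tens (K : fieldType) m1 p1 m2 p2
    (q : quad K m1 p1) (q' : quad K m2 p2) :
    quad K (m1 + m2)%N (p1 + p2)%N :=
  Quad (dsum_mx (qd q) (qd q')) (dsum_mx (qc q) (qc q'))
       (dsum_mx (qa q) (qa q')) (dsum_mx (qb q) (qb q')).

Definition box_comp (K : fieldType) m n p
    (g : box_hom K n p) (f : box_hom K m n) : box_hom K m p :=
  box_class (quad_comp (box_repr g) (box_repr f)).

Definition box_tens (K : fieldType) m1 p1 m2 p2
    (f : box_hom K m1 p1) (g : box_hom K m2 p2) :
    box_hom K (m1 + m2)%N (p1 + p2)%N :=
  box_class (quad_tens (box_repr f) (box_repr g)).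

(* The operations do not depend on the chosen representatives. *)
Lemma box_compE (K : fieldType) m n p (q' : quad K n p) (q : quad K m n) :
  box_comp (box_class q') (box_class q) = box_class (quad_comp q' q).
Proof.
apply/box_classP.
have [ed' [al' [om' [il' io' eb' ea' ec']]]] := box_repr_class q'.
have [ed [al [om [il io eb ea ec]]]] := box_repr_class q.
split; first by rewrite /= ed ed'.
exists (dsum_mx al al'), (dsum_mx om om'); split => /=.
- exact: mx_iso_dsum.
- exact: mx_iso_dsum.
- rewrite /dsum_mx mul_block_col !mul0mx addr0 add0r eb.
  by rewrite mulmxA eb' ed.
- rewrite /dsum_mx !mulmx_block !mul0mx !mulmx0 !addr0 !add0r ea ea'.
  by rewrite !mulmxA ea' ec -(mulmxA _ al') eb' -!mulmxA ea !mulmxA.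
- rewrite /dsum_mx mul_row_block !mulmx0 addr0 add0r -ec' -mulmxA -ec.
  by rewrite ed'.
Qed.

Lemma box_tensE (K : fieldType) m1 p1 m2 p2
    (q : quad K m1 p1) (q' : quad K m2 p2) :
  box_tens (box_class q) (box_class q') = box_class (quad_tens q q').
Proof.
apply/box_classP.
have [ed' [al' [om' [il' io' eb' ea' ec']]]] := box_repr_class q'.
have [ed [al [om [il io eb ea ec]]]] := box_repr_class q.
split; first by rewrite /= ed ed'.
exists (dsum_mx al al'), (dsum_mx om om'); split => /=.
- exact: mx_iso_dsum.
- exact: mx_iso_dsum.
- by rewrite -dsum_mxM eb eb'.
- by rewrite -!dsum_mxM ea ea'.
- by rewrite -dsum_mxM -ec -ec'.
Qed.

Definition Box (K : fieldType) : PROP_data :=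
  @PROPData (box_hom K)
    (fun n => box_class (quad_of_mx (1%:M : 'M[K]_n)))
    (@box_comp K)
    (@box_tens K)
    (fun m n => box_class (quad_of_mx (swap_mx K m n))).

Definition ratfun (k : fieldType) : fieldType := {fraction {poly k}}.

Definition ratfun_var (k : fieldType) : ratfun k := FracField.tofrac 'X.

Definition ratfun_const (k : fieldType) (x : k) : ratfun k :=
  FracField.tofrac x%:P.

Definition ext_mx (k : fieldType) m n (A : 'M[k]_(m, n)) :
    'M[ratfun k]_(m, n) :=
  map_mx (@ratfun_const k) A.

Definition sI_sub (k : fieldType) n (A : 'M[k]_n) : 'M[ratfun k]_n :=
  (ratfun_var k)%:M - ext_mx A.

(* Hence [invmx (sI_sub A)] is a genuine inverse. *)
Lemma sI_sub_unit (k : fieldType) n (A : 'M[k]_n) : sI_sub A \in unitmx.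
Proof.
have -> : sI_sub A = map_mx (@FracField.tofrac {poly k}) (char_poly_mx A).
  apply/matrixP=> i j; rewrite !mxE rmorphB rmorphMn //=.
rewrite unitmxE det_map_mx unitfE tofrac_eq0.
exact: monic_neq0 (char_poly_monic A).
Qed.

Definition stateful (k : fieldType) m p (f : hom (Box (ratfun k)) m p) : Prop :=
  exists (n : nat) (A : 'M[k]_n) (B : 'M[k]_(n, m)) (C : 'M[k]_(p, n))
         (D : 'M[k]_(p, m)),
    f = box_class (Quad (ext_mx D) (ext_mx C) (invmx (sI_sub A)) (ext_mx B)).

Definition Stateful (k : fieldType) (h : sub_closed (@stateful k)) : PROP_data :=
  sub_PROP_data h.

(* Main.v *)
Require Import Defs.
From mathcomp Require Import all_boot all_order all_algebra.
From HB Require Import structures.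
From mathcomp Require Import boolp.

Set Implicit Arguments.
Unset Strict Implicit.
Unset Printing Implicit Defensive.

Import GRing.Theory.
Local Open Scope ring_scope.

(** Stateful morphisms contain the identities and the symmetries (take the
    state space 0), and they are closed under the two operations because of
    two facts about block matrices:
    - the inverse of sI minus a block triangular matrix (A, 0; E, A') is block
      triangular with lower left entry (sI - A')^-1 E (sI - A)^-1
      ([invmx_sI_sub_ltri]); for E = B'C this is exactly the entry a'b'ca in
      the composition of the box, so the composite of two systems is the
      system with state matrix (A, 0; B'C, A');
    - for E = 0 the same formula inverts a direct sum, so the monoidal product
      of two systems is the system whose state matrix is the direct sum of A
      and A'.

    The PROP laws are equations between morphisms, so a subfamily closed under the operations
    inherits them ([sub_is_PROP]) from the box of any field ([Box_is_PROP]).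
    In the box, each law holds for representatives up to an evident
    isomorphism of the intermediate spaces: reassociation for associativity
    of both operations, S + 0 = S for the units, the middle interchange of
    direct summands for functoriality of the product ([quad_tens_comp]), and
    the swap of two summands for naturality of the symmetry.  Composing with
    a morphism that comes from a matrix only multiplies the outer entries
    ([box_comp_mxl], [box_comp_mxr]), so the laws on composition with
    identities and symmetries reduce to identities between matrices. *)

(** * Block matrices *)

Section BlockMatrices.
Variable K : fieldType.

Lemma castmx_dsumA m1 n1 m2 n2 m3 n3
    (f : 'M[K]_(n1, m1)) (g : 'M[K]_(n2, m2)) (h : 'M[K]_(n3, m3)) :
  castmx (addnA n1 n2 n3, addnA m1 m2 m3) (dsum_mx f (dsum_mx g h))
  = dsum_mx (dsum_mx f g) h.
Proof.
rewrite /dsum_mx -(row_mx0 K n1 m2 m3) -(col_mx0 K n2 n3 m1).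
rewrite block_mxA castmx_comp castmx_id.
by rewrite ?row_mx0 ?col_mx0.
Qed.

Lemma castmx_dsum0l m n (z : 'M[K]_0) (f : 'M[K]_(n, m)) :
  castmx (add0n n, add0n m) (dsum_mx z f) = f.
Proof.
apply/matrixP=> i j; rewrite castmxE /= -[RHS](block_mxEdr z 0 0).
by congr (block_mx _ _ _ _ _ _); apply/val_inj.
Qed.

Lemma castmx_dsum0r m n (z : 'M[K]_0) (f : 'M[K]_(n, m)) :
  castmx (addn0 n, addn0 m) (dsum_mx f z) = f.
Proof.
apply/matrixP=> i j; rewrite castmxE /= -[RHS](block_mxEul f 0 0 z).
by congr (block_mx _ _ _ _ _ _); apply/val_inj.
Qed.

Lemma dsum_mx1 m n : dsum_mx (1%:M : 'M[K]_m) (1%:M : 'M[K]_n) = 1%:M.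
Proof. by rewrite /dsum_mx -scalar_mx_block. Qed.

Lemma swap_mxK m n : swap_mx K n m *m swap_mx K m n = 1%:M.
Proof.
by rewrite /swap_mx mulmx_block !mulmx0 !mulmx1 !addr0 !add0r -scalar_mx_block.
Qed.

Lemma mx_iso_swap m n : mx_iso (swap_mx K m n).
Proof. by exists (swap_mx K n m); apply: swap_mxK. Qed.

Lemma swap_mx_dsum m1 n1 m2 n2 (f : 'M[K]_(n1, m1)) (g : 'M[K]_(n2, m2)) :
  swap_mx K n1 n2 *m dsum_mx f g = dsum_mx g f *m swap_mx K m1 m2.
Proof.
by rewrite /swap_mx /dsum_mx !mulmx_block !(mulmx0, mul0mx, mulmx1, mul1mx,
  addr0, add0r).
Qed.

Lemma castmx_swap0 m :
  castmx (add0n m, addn0 m) (swap_mx K m 0) = 1%:M.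
Proof.
apply/matrixP=> i j; rewrite castmxE /=.
rewrite -[RHS](block_mxEdl (0 : 'M[K]_(0, m)) 1%:M _ 0).
by congr (block_mx _ _ _ _ _ _); apply/val_inj.
Qed.

Lemma castmx_col3 a b c m m' (em : m = m')
    (X : 'M[K]_(a, m)) (Y : 'M[K]_(b, m)) (Z : 'M[K]_(c, m)) :
  castmx (esym (addnA a b c), em) (col_mx (col_mx X Y) Z)
  = col_mx (castmx (erefl a, em) X)
           (col_mx (castmx (erefl b, em) Y) (castmx (erefl c, em) Z)).
Proof. by case: m' / em; rewrite !castmx_id col_mxA. Qed.

Lemma castmx_row3 r a b c
    (X : 'M[K]_(r, a)) (Y : 'M[K]_(r, b)) (Z : 'M[K]_(r, c)) :
  castmx (erefl r, addnA a b c) (row_mx X (row_mx Y Z))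
  = row_mx (row_mx X Y) Z.
Proof. by rewrite row_mxA castmx_comp castmx_id. Qed.

(** Reassociation of the three summands of a block lower triangular matrix;
    this compares the middle entries of the two ways of composing three
    quadruples. *)
Lemma castmx_ltri a b c a' b' c'
    (A : 'M[K]_(a, a')) (B : 'M_(b, a')) (D : 'M_(b, b'))
    (E : 'M_(c, a')) (F : 'M_(c, b')) (G : 'M_(c, c')) :
  castmx (esym (addnA a b c), esym (addnA a' b' c'))
    (block_mx (block_mx A 0 B D) 0 (row_mx E F) G)
  = block_mx A 0 (col_mx B E) (block_mx D 0 F G).
Proof. by rewrite -(row_mx0 K a b' c') block_mxA col_mx0. Qed.

(** Cut into blocks of sizes n, p, m by m, n, p, both sides are the matrix of
    (x, y, z) |-> (y, z, x). *)
Lemma swap_mx_hexagon m n p :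
  castmx (esym (addnA n p m), addnA m n p) (swap_mx K m (n + p))
  = dsum_mx 1%:M (swap_mx K m p)
    *m castmx (esym (addnA n m p), erefl (m + n + p)%N)
              (dsum_mx (swap_mx K m n) 1%:M).
Proof.
(* All blocks of both sides are made visible as a column of three rows, each
   row consisting of three blocks. *)
have -> : swap_mx K m (n + p) =
  col_mx (col_mx (row_mx 0 (row_mx 1%:M 0)) (row_mx 0 (row_mx 0 1%:M)))
         (row_mx 1%:M (row_mx 0 0)).
  rewrite row_mx0 -[in RHS]block_mxEv [in RHS]block_mxEh col_mx0.
  by rewrite /swap_mx scalar_mx_block.
have -> : dsum_mx (swap_mx K m n) (1%:M : 'M[K]_p) =
  col_mx (col_mx (row_mx (row_mx 0 1%:M) 0) (row_mx (row_mx 1%:M 0) 0))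
         (row_mx (row_mx 0 0) 1%:M).
  by rewrite -[in RHS]block_mxEv [in RHS]block_mxEh col_mx0 row_mx0.
rewrite !castmx_col3 !castmx_row3 !castmx_id /dsum_mx /swap_mx.
by rewrite !mul_block_col !mul0mx !mul1mx !addr0 !add0r.
Qed.

(** The map (x, x', y, y') |-> (x, y, x', y'), which exchanges the two middle
    summands: the intermediate spaces of a product of composites are ordered
    differently from those of a composite of products. *)
Definition interchange_mx a a' b b' :
    'M[K]_((a + b) + (a' + b'), (a + a') + (b + b')) :=
  block_mx (block_mx 1%:M 0 0 0) (block_mx 0 0 1%:M 0)
           (block_mx 0 1%:M 0 0) (block_mx 0 0 0 1%:M).

Lemma interchange_mxK a a' b b' :
  interchange_mx a b a' b' *m interchange_mx a a' b b' = 1%:M.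
Proof.
rewrite /interchange_mx !mulmx_block !(mulmx0, mul0mx, mulmx1, addr0, add0r).
by rewrite !add_block_mx !(addr0, add0r) !block_mx0 -!scalar_mx_block.
Qed.

Lemma mx_iso_interchange a a' b b' : mx_iso (interchange_mx a a' b b').
Proof. by exists (interchange_mx a b a' b'); apply: interchange_mxK. Qed.

Lemma interchange_mx_col m m' a a' b b'
    (x : 'M[K]_(a, m)) (x' : 'M_(a', m)) (y : 'M_(b, m')) (y' : 'M_(b', m')) :
  interchange_mx a a' b b' *m dsum_mx (col_mx x x') (col_mx y y')
  = col_mx (dsum_mx x y) (dsum_mx x' y').
Proof.
rewrite /interchange_mx /dsum_mx mulmx_block !(mulmx0, addr0, add0r).
rewrite !mul_block_col !(mul0mx, mul1mx, addr0, add0r).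
by rewrite (block_mxEh x) (block_mxEh x') -block_mxEv block_mxEh.
Qed.

Lemma interchange_mx_row p p' a a' b b'
    (x : 'M[K]_(p, a)) (x' : 'M_(p, a')) (y : 'M_(p', b)) (y' : 'M_(p', b')) :
  row_mx (dsum_mx x y) (dsum_mx x' y') *m interchange_mx a a' b b'
  = dsum_mx (row_mx x x') (row_mx y y').
Proof.
rewrite /interchange_mx /dsum_mx mul_row_block !mulmx_block.
rewrite !(mulmx0, mul0mx, mulmx1, addr0, add0r) !add_block_mx !(addr0, add0r).
by rewrite [RHS]block_mxEh -(row_mx0 K p' a a') -(row_mx0 K p b b').
Qed.

Lemma interchange_mx_ltri a a' b b' c c' d d'
    (x : 'M[K]_(c, a)) (w : 'M_(c', a)) (x' : 'M_(c', a'))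
    (y : 'M[K]_(d, b)) (v : 'M_(d', b)) (y' : 'M_(d', b')) :
  interchange_mx c c' d d' *m dsum_mx (block_mx x 0 w x') (block_mx y 0 v y')
  = block_mx (dsum_mx x y) 0 (dsum_mx w v) (dsum_mx x' y')
    *m interchange_mx a a' b b'.
Proof.
rewrite /interchange_mx /dsum_mx !mulmx_block.
rewrite !(mulmx0, mul0mx, mulmx1, mul1mx, addr0, add0r).
by rewrite !add_block_mx !(addr0, add0r).
Qed.

End BlockMatrices.

(** * The box construction is a PROP *)

Section Box.
Variable K : fieldType.

Lemma box_elim m p (P : box_hom K m p -> Prop) :
  (forall q, P (box_class q)) -> forall f, P f.
Proof. by move=> Pq f; rewrite -(box_reprK f). Qed.

(** Transport along equalities of the intermediate dimensions does not change
    a morphism: this is how reassociating S and T is absorbed by the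
    quotient. *)
Lemma box_class_castS m p S S' T T' (eS : S = S') (eT : T = T')
    (d : 'M[K]_(p, m)) (c : 'M_(p, T)) (a : 'M_(T, S)) (b : 'M_(S, m)) :
  box_class (Quad d (castmx (erefl p, eT) c) (castmx (eT, eS) a)
                  (castmx (eS, erefl m) b))
  = box_class (Quad d c a b).
Proof. by case: S' / eS; case: T' / eT; rewrite !castmx_id. Qed.

Lemma cast_box_class m m' p p' (em : m = m') (ep : p = p') S T
    (d : 'M[K]_(p, m)) (c : 'M_(p, T)) (a : 'M_(T, S)) (b : 'M_(S, m)) :
  @cast_hom (Box K) m m' p p' em ep (box_class (Quad d c a b))
  = box_class (Quad (castmx (ep, em) d) (castmx (ep, erefl T) c) a
                    (castmx (erefl S, em) b)).
Proof. by case: m' / em; case: p' / ep; rewrite !castmx_id. Qed.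

Lemma cast_box_mx m m' p p' (em : m = m') (ep : p = p') (d : 'M[K]_(p, m)) :
  @cast_hom (Box K) m m' p p' em ep (box_class (quad_of_mx d))
  = box_class (quad_of_mx (castmx (ep, em) d)).
Proof. by case: m' / em; case: p' / ep; rewrite castmx_id. Qed.

Lemma mx_iso_inl n : mx_iso (row_mx 1%:M 0 : 'M[K]_(n, n + 0)).
Proof.
exists (col_mx 1%:M 0); last by rewrite mul_row_col mulmx1 mulmx0 addr0.
rewrite mul_col_row !(mulmx1, mul0mx, mulmx0) scalar_mx_block.
by congr block_mx; rewrite [RHS]flatmx0.
Qed.

Lemma mx_iso_inr n : mx_iso (row_mx 0 1%:M : 'M[K]_(n, 0 + n)).
Proof.
exists (col_mx 0 1%:M); last by rewrite mul_row_col mulmx1 mulmx0 add0r.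
rewrite mul_col_row !(mulmx1, mul0mx, mulmx0) [RHS]scalar_mx_block.
by congr block_mx; rewrite [RHS]flatmx0.
Qed.

(** The quadruple of a matrix has intermediate spaces 0, so the composite has
    intermediate spaces S + 0 and T + 0, isomorphic to S and T. *)
Lemma box_comp_mxl m n p (e : 'M[K]_(p, n)) (q : quad K m n) :
  box_comp (box_class (quad_of_mx e)) (box_class q)
  = box_class (Quad (e *m qd q) (e *m qc q) (qa q) (qb q)).
Proof.
rewrite box_compE; apply/box_classP; split=> //=.
exists (row_mx 1%:M 0), (row_mx 1%:M 0); split; try exact: mx_iso_inl.
- by rewrite mul_row_col mul1mx mul0mx addr0.
- by rewrite mul_row_block !mul1mx !mul0mx !addr0 mul_mx_row mulmx1 mulmx0.
- by rewrite mul_mx_row mulmx1 mulmx0.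
Qed.

Lemma box_comp_mxr m n p (q : quad K n p) (e : 'M[K]_(n, m)) :
  box_comp (box_class q) (box_class (quad_of_mx e))
  = box_class (Quad (qd q *m e) (qc q) (qa q) (qb q *m e)).
Proof.
rewrite box_compE; apply/box_classP; split=> //=.
exists (row_mx 0 1%:M), (row_mx 0 1%:M); split; try exact: mx_iso_inr.
- by rewrite mul_row_col mul1mx mul0mx add0r.
- rewrite mul_row_block !mul1mx !mul0mx !add0r mul_mx_row mulmx1 mulmx0.
  by rewrite !mulmx0.
- by rewrite mul_mx_row mulmx1 !mulmx0.
Qed.

Lemma box_comp_mx m n p (e : 'M[K]_(p, n)) (f : 'M[K]_(n, m)) :
  box_comp (box_class (quad_of_mx e)) (box_class (quad_of_mx f))
  = box_class (quad_of_mx (e *m f)).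
Proof. by rewrite box_comp_mxl /= mulmx0. Qed.

Lemma box_tens_mx m1 n1 m2 n2 (e : 'M[K]_(n1, m1)) (f : 'M[K]_(n2, m2)) :
  box_tens (box_class (quad_of_mx e)) (box_class (quad_of_mx f))
  = box_class (quad_of_mx (dsum_mx e f)).
Proof.
by rewrite box_tensE /quad_tens /quad_of_mx /dsum_mx /= !block_mx0.
Qed.

(** Both sides have the three matrices a on the diagonal, and below it the sum
    over all paths from an earlier to a later system, through the middle one
    or around it by its feedthrough d. *)
Lemma quad_compA m n p q (z : quad K p q) (y : quad K n p) (x : quad K m n) :
  box_class (quad_comp z (quad_comp y x))
  = box_class (quad_comp (quad_comp z y) x).
Proof.
rewrite -(box_class_castS (esym (addnA (qS x) (qS y) (qS z)))
                          (esym (addnA (qT x) (qT y) (qT z)))).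
congr box_class; rewrite /quad_comp /=; congr Quad.
- by rewrite mulmxA.
- by rewrite mul_mx_row !mulmxA row_mxA.
- rewrite mul_mx_row mul_row_block !(mulmx0, addr0, add0r) castmx_ltri.
  by rewrite mul_block_col mul0mx addr0 !mul_col_mx !(mulmxDl, mulmxA) addrC.
- by rewrite castmx_col3 !castmx_id mul_col_mx !mulmxA.
Qed.

Lemma quad_tens_comp m1 n1 p1 m2 n2 p2
    (y1 : quad K n1 p1) (x1 : quad K m1 n1)
    (y2 : quad K n2 p2) (x2 : quad K m2 n2) :
  box_class (quad_tens (quad_comp y1 x1) (quad_comp y2 x2))
  = box_class (quad_comp (quad_tens y1 y2) (quad_tens x1 x2)).
Proof.
apply/box_classP; split; first by rewrite /= dsum_mxM.
exists (interchange_mx K _ _ _ _), (interchange_mx K _ _ _ _).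
split; rewrite /= -?dsum_mxM; try exact: mx_iso_interchange.
- exact: interchange_mx_col.
- exact: interchange_mx_ltri.
- exact/esym/interchange_mx_row.
Qed.

Lemma quad_tensA m1 n1 m2 n2 m3 n3
  (x : quad K m1 n1) (y : quad K m2 n2) (z : quad K m3 n3) :
  @cast_hom (Box K) _ _ _ _ (addnA m1 m2 m3) (addnA n1 n2 n3)
     (box_class (quad_tens x (quad_tens y z)))
  = box_class (quad_tens (quad_tens x y) z).
Proof.
rewrite cast_box_class -(box_class_castS (addnA (qS x) (qS y) (qS z))
                          (addnA (qT x) (qT y) (qT z))).
by rewrite !castmx_comp /= !etrans_id !castmx_dsumA.
Qed.

Lemma Box_is_PROP : is_PROP (Box K).
Proof.
split => /=.
- move=> m n p q h g f.
  elim/box_elim: h => z; elim/box_elim: g => y; elim/box_elim: f => x.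
  by rewrite !box_compE quad_compA.
- move=> m n; elim/box_elim => q.
  by rewrite box_comp_mxl !mul1mx; case: q.
- move=> m n; elim/box_elim => q.
  by rewrite box_comp_mxr !mulmx1; case: q.
- by move=> m n; rewrite box_tens_mx dsum_mx1.
- move=> m1 n1 p1 m2 n2 p2 g1 f1 g2 f2.
  elim/box_elim: g1 => y1; elim/box_elim: f1 => x1.
  elim/box_elim: g2 => y2; elim/box_elim: f2 => x2.
  by rewrite !(box_compE, box_tensE) quad_tens_comp.
- move=> m1 n1 m2 n2 m3 n3 f g h.
  elim/box_elim: h => z; elim/box_elim: g => y; elim/box_elim: f => x.
  by rewrite !box_tensE quad_tensA.
- move=> m n; elim/box_elim => q.
  rewrite box_tensE cast_box_class.
  rewrite -(box_class_castS (add0n (qS q)) (add0n (qT q))).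
  by rewrite !castmx_comp /= !etrans_id !castmx_dsum0l; case: q.
- move=> m n; elim/box_elim => q.
  rewrite box_tensE cast_box_class.
  rewrite -(box_class_castS (addn0 (qS q)) (addn0 (qT q))).
  by rewrite !castmx_comp /= !etrans_id !castmx_dsum0r; case: q.
- move=> m1 n1 m2 n2 f g.
  elim/box_elim: g => y; elim/box_elim: f => x.
  rewrite !box_tensE box_comp_mxl box_comp_mxr /= !swap_mx_dsum.
  apply/box_classP; split => //=.
  exists (swap_mx K _ _), (swap_mx K _ _).
  by split; rewrite ?swap_mx_dsum //; apply: mx_iso_swap.
- by move=> m n; rewrite box_comp_mx swap_mxK.
- move=> m n p.
  by rewrite !box_tens_mx !cast_box_mx box_comp_mx swap_mx_hexagon.
- by move=> m; rewrite cast_box_mx castmx_swap0.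
Qed.

End Box.

(** * Sub-PROPs *)

Section SubPROP.
Variables (P : PROP_data) (S : forall m n, Defs.hom P m n -> Prop).
Hypothesis hS : sub_closed S.

Lemma sub_homP m n (f g : Defs.hom (sub_PROP_data hS) m n) :
  sval f = sval g -> f = g.
Proof. by move: f g => [f Sf] [g Sg] /= ?; apply: eq_exist. Qed.

Lemma sval_cast_hom m m' n n' (em : m = m') (en : n = n')
    (f : Defs.hom (sub_PROP_data hS) m n) :
  sval (cast_hom em en f) = cast_hom em en (sval f).
Proof. by case: m' / em; case: n' / en. Qed.

Lemma sub_is_PROP : is_PROP P -> is_PROP (sub_PROP_data hS).
Proof.
move=> PP; split=> *; apply: sub_homP; rewrite ?sval_cast_hom /= ?sval_cast_hom.
- exact: Defs.compA.
- exact: comp1m.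
- exact: compm1.
- exact: tens1.
- exact: tens_comp.
- exact: tensA.
- exact: tens0m.
- exact: tensm0.
- exact: sym_nat.
- exact: symK.
- exact: sym_hexagon.
- exact: sym_unit.
Qed.

End SubPROP.

(** * Stateful morphisms *)

Section Stateful.
Variable k : fieldType.

(* Extension of scalars along a ring morphism preserves products, blocks and
   scalar matrices. *)
HB.instance Definition _ :=
  GRing.RMorphism.copy (@ratfun_const k)
    (@FracField.tofrac {poly k} \o @polyC k).

Lemma ext_mx1 n : ext_mx (1%:M : 'M[k]_n) = 1%:M.
Proof. exact: map_mx1. Qed.

Lemma ext_dsum_mx m1 n1 m2 n2 (A : 'M[k]_(n1, m1)) (B : 'M[k]_(n2, m2)) :
  ext_mx (dsum_mx A B) = dsum_mx (ext_mx A) (ext_mx B).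
Proof. by rewrite /ext_mx /dsum_mx map_block_mx !map_mx0. Qed.

Lemma ext_swap_mx m n : ext_mx (swap_mx k m n) = swap_mx _ m n.
Proof. by rewrite /ext_mx /swap_mx map_block_mx !map_mx0 !map_mx1. Qed.

Lemma invmx_uniq (F : fieldType) n (M N : 'M[F]_n) : M *m N = 1%:M -> invmx M = N.
Proof.
by move=> MN; have [uM _] := mulmx1_unit MN; rewrite -[RHS](mulKmx uM) MN mulmx1.
Qed.

(** Multiplying by the matrix with blocks sI - A, 0, - E, sI - A' cancels the
    two terms of the lower left entry.  That entry is what makes composition
    in the box preserve statefulness. *)
Lemma invmx_sI_sub_ltri n n' (A : 'M[k]_n) (A' : 'M[k]_n') (E : 'M[k]_(n', n)) :
  invmx (sI_sub (block_mx A 0 E A'))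
  = block_mx (invmx (sI_sub A)) 0
      (invmx (sI_sub A') *m ext_mx E *m invmx (sI_sub A)) (invmx (sI_sub A')).
Proof.
apply: invmx_uniq.
have -> : sI_sub (block_mx A 0 E A')
          = block_mx (sI_sub A) 0 (- ext_mx E) (sI_sub A').
  rewrite /sI_sub /ext_mx map_block_mx map_mx0 scalar_mx_block.
  by rewrite opp_block_mx add_block_mx oppr0 addr0 add0r.
rewrite mulmx_block !(mulmx0, mul0mx, addr0, add0r) !mulmxA.
by rewrite !mulmxV ?sI_sub_unit // mul1mx mulNmx addNr -scalar_mx_block.
Qed.

Lemma stateful_mx m n (D : 'M[k]_(n, m)) :
  @stateful k m n (box_class (quad_of_mx (ext_mx D))).
Proof.
(* A system with state space 0: all entries but D have an empty dimension. *)
exists 0%N, 0, 0, 0, D; congr (box_class (Quad _ _ _ _)).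
- by rewrite [RHS]thinmx0.
- by rewrite [RHS]flatmx0.
- by rewrite [RHS]flatmx0.
Qed.

Lemma stateful_closed : sub_closed (@stateful k).
Proof.
split=> /=.
- by move=> n; rewrite -ext_mx1; apply: stateful_mx.
- move=> m n p _ _ [n2 [A2 [B2 [C2 [D2 ->]]]]] [n1 [A1 [B1 [C1 [D1 ->]]]]].
  exists (n1 + n2)%N, (block_mx A1 0 (B2 *m C1) A2), (col_mx B1 (B2 *m D1)),
    (row_mx (D2 *m C1) C2), (D2 *m D1).
  rewrite box_compE invmx_sI_sub_ltri /quad_comp /=.
  by rewrite /ext_mx map_row_mx map_col_mx !map_mxM !mulmxA.
- move=> m1 p1 m2 p2 _ _ [n1 [A1 [B1 [C1 [D1 ->]]]]] [n2 [A2 [B2 [C2 [D2 ->]]]]].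
  exists (n1 + n2)%N, (dsum_mx A1 A2), (dsum_mx B1 B2), (dsum_mx C1 C2),
    (dsum_mx D1 D2).
  rewrite box_tensE invmx_sI_sub_ltri !ext_dsum_mx /quad_tens /=.
  by rewrite /ext_mx map_mx0 mulmx0 mul0mx.
- by move=> m n; rewrite -ext_swap_mx; apply: stateful_mx.
Qed.

End Stateful.

(* The existential asserts that the operations of the box restrict to stateful
   morphisms, so that Stateful k is well defined; as [sub_closed] is a Prop, its
   witness carries no other information. *)
Theorem mainTheorem5 (k : fieldType) :
  exists h : sub_closed (@stateful k), is_PROP (Stateful h).
Proof.
by exists (stateful_closed k); apply/sub_is_PROP/Box_is_PROP.
Qed.
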